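(* For any locally compact quantum group $\mathbb G$, the $C^*$-Eberlein algebra $E(\mathbb G)=(\mathcal E(\mathbb G),\Phi_{\mathbb G},U_{\mathbb G},H_{\mathbb G})$ admits a unique invariant mean.
   Context: $\mathbb G$ is a locally compact quantum group in the sense of Kustermans–Vaes, with universal $C^*$-algebra $C_0^u(\mathbb G)$ and coproduct $\Delta_u$; $C_0^u(\mathbb G)^*$ is a Banach algebra with product $\langle\mu\star\lambda,a\rangle=(\mu\otimes\lambda)\Delta_u(a)$. A unitary corepresentation of $C_0^u(\mathbb G)$ on $H$ is a unitary $U\in M(C_0^u(\mathbb G)\otimes\mathcal B_0(H))$ with $(\Delta_u\otimes\mathrm{id})(U)=U_{13}U_{23}$. A $C^*$-Eberlein algebra is a quadruple $(A,\Phi,V,H)$ where: (1) $A$ is a $C^*$-algebra, $\Phi:A\to A^{**}\overline\otimes A^{**}$ is a unital $*$-homomorphism (if $A$ is non-unital, this means the normal extension is unital), $H$ is a Hilbert space and $V\in A^{**}\overline\otimes\mathcal B(H)$ is a contraction; (2) $A_V:=\{(\mathrm{id}\otimes\omega)(V):\omega\in\mathcal B(H)_*\}$ is a subset of $A\subseteq A^{**}$ and is norm dense in $A$; (3) the bilinear product on $A^*$ given by $\langle\mu\star\nu,a\rangle=\langle\Phi(a),\mu\otimes\nu\rangle$ is associative; (4) the map $A^*\to\mathcal B(H)$, $\mu\mapsto(\mu\otimes\mathrm{id})(V)$ is a homomorphism for $\star$. Embedded $C^*$-Eberlein algebras of $\mathbb G$: let $U\in M(C_0^u(\mathbb G)\otimes\mathcal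 B_0(K))$ be a unitary corepresentation such that the norm closure $B$ of $\{(\mathrm{id}\otimes\omega)(U):\omega\in\mathcal B(K)_*\}$ is a $C^*$-subalgebra of $M(C_0^u(\mathbb G))$. Let $U'\in B^{**}\overline\otimes\mathcal B(K)$ be determined by $(\mathrm{id}\otimes\omega)(U')=(\mathrm{id}\otimes\omega)(U)\in B$ for all $\omega$. There is a unique $\Phi_B$ such that $(B,\Phi_B,U',K)$ is a $C^*$-Eberlein algebra for which the restriction map $C_0^u(\mathbb G)^*\to B^*$ (functionals extended strictly to $M(C_0^u(\mathbb G))$) is a homomorphism; those arising in this way are the embedded ones. $E(\mathbb G)$ denotes a unital embedded $C^*$-Eberlein algebra whose underlying algebra $\mathcal E(\mathbb G)\subseteq M(C_0^u(\mathbb G))$ contains the underlying algebra of every other unital embedded $C^*$-Eberlein algebra; it exists, and $\mathcal E(\mathbb G),\Phi_{\mathbb G}$ are unique. For a $C^*$-Eberlein algebra $(A,\Phi,V,H)$ with $A$ unital, $A$ is an $A^*$-bimodule via $\langle a\cdot\mu,\lambda\rangle=\langle\mu\star\lambda,a\rangle$, $\langle\mu\cdot a,\lambda\rangle=\langle\lambda\star\mu,a\rangle$. An invariant mean is a state $M\in A^*$ with $\langle M,a\cdot\mu\rangle=\langle M,a\rangle=\langle M,\mu\cdot a\rangle$ for all states $\mu\in A^*$ and all $a\in A$. *)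

(* Defs.v *)
From HB Require Import structures.
From mathcomp Require Import all_boot all_order all_algebra.
From mathcomp Require Import complex.
From mathcomp Require Import all_classical all_reals all_analysis.

Set Implicit Arguments.
Unset Strict Implicit.
Unset Printing Implicit Defensive.

Import Order.TTheory GRing.Theory Num.Theory numFieldNormedType.Exports.
Local Open Scope classical_set_scope.
Local Open Scope ring_scope.
Local Open Scope complex_scope.

(* The norm of a normed module over [R[i]] takes its values in [R[i]], hence
   [hdot_norm]; the inner product is linear in its first argument. *)
Record hilbert (R : realType) := Hilbert {
  hspace :> completeNormedModType R[i];
  hdot : hspace -> hspace -> R[i];
  hdot_linear : forall (a : R[i]) (x y z : hspace),
    hdot (a *: x + y) z = a * hdot x z + hdot y z;
  hdot_conj : forall x y : hspace, hdot y x = (hdot x y)^*;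
  hdot_norm : forall x : hspace, hdot x x = `|x| ^+ 2 }.

Section HilbertTheory.
Variables (R : realType) (H : hilbert R).
Implicit Types x y z : H.

Lemma hdotDl x y z : hdot (x + y) z = hdot x z + hdot y z.
Proof. by have := hdot_linear 1 x y z; rewrite scale1r mul1r. Qed.

Lemma hdot0l z : hdot 0 z = 0.
Proof. by apply: (addrI (hdot 0 z)); rewrite -hdotDl !addr0. Qed.

Lemma hdotZl a x z : hdot (a *: x) z = a * hdot x z.
Proof. by have := hdot_linear a x 0 z; rewrite addr0 hdot0l addr0. Qed.

Lemma hdotNl x z : hdot (- x) z = - hdot x z.
Proof. by rewrite -scaleN1r hdotZl mulN1r. Qed.

Lemma hdotDr x y z : hdot z (x + y) = hdot z x + hdot z y.
Proof. by rewrite !(hdot_conj _ z) hdotDl rmorphD. Qed.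

Lemma hdot0r z : hdot z 0 = 0.
Proof. by rewrite hdot_conj hdot0l rmorph0. Qed.

Lemma hdotZr a x z : hdot z (a *: x) = a^* * hdot z x.
Proof. by rewrite !(hdot_conj _ z) hdotZl rmorphM. Qed.

Lemma hdotNr x z : hdot z (- x) = - hdot z x.
Proof. by rewrite !(hdot_conj _ z) hdotNl rmorphN. Qed.

Lemma hdot_inj x y : (forall z, hdot z x = hdot z y) -> x = y.
Proof.
move=> h; apply/eqP; rewrite -subr_eq0 -normr_eq0 -sqrf_eq0 -hdot_norm.
by rewrite hdotDr hdotNr h subrr.
Qed.

(* A bounded operator is packaged with its adjoint, which always exists and is
   unique (see [bop_eq]), so that the involution of B(H) is a plain function. *)
Record bop := Bop {
  bfun :> {linear H -> H};
  bfun_continuous : continuous bfun;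
  badj : H -> H;
  badjE : forall x y, hdot (bfun x) y = hdot x (badj y) }.

Lemma bop_eq (X Y : bop) : (forall x, X x = Y x) -> X = Y.
Proof.
case: X Y => [f cf f' ff'] [g cg g' gg'] /= h.
have eqf : f = g.
  case: f g h {cf cg ff' gg'} => f [[af] [bf]] [g [[ag] [bg]]] /= h.
  have e : f = g by apply/funext.
  by subst g; rewrite (Prop_irrelevance af ag) (Prop_irrelevance bf bg).
subst g.
have eqf' : f' = g'.
  by apply/funext => y; apply: hdot_inj => z; rewrite -ff' gg'.
by subst g'; rewrite (Prop_irrelevance cf cg) (Prop_irrelevance ff' gg').
Qed.

HB.instance Definition _ := gen_eqMixin bop.
HB.instance Definition _ := gen_choiceMixin bop.

Lemma badjEr (X : bop) x y : hdot (badj X x) y = hdot x (X y).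
Proof. by rewrite hdot_conj -badjE -hdot_conj. Qed.

Lemma badj_linear (X : bop) : linear (badj X).
Proof.
move=> a x y; apply: hdot_inj => z.
by rewrite hdotDr hdotZr -!badjE hdotDr hdotZr.
Qed.

Fact bop0_continuous : continuous (\0 : {linear H -> H}).
Proof. by move=> x; exact: cvg_cst. Qed.

Fact bop0_adj x y : hdot ((\0 : {linear H -> H}) x) y = hdot x ((fun=> 0) y).
Proof. by rewrite hdot0l hdot0r. Qed.

Definition bop0 : bop := Bop bop0_continuous bop0_adj.

Fact bop1_continuous : continuous (idfun : {linear H -> H}).
Proof. by move=> x; exact: cvg_id. Qed.

Fact bop1_adj x y : hdot ((idfun : {linear H -> H}) x) y = hdot x (id y).
Proof. by []. Qed.

Definition bop1 : bop := Bop bop1_continuous bop1_adj.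

Fact bopD_continuous (X Y : bop) : continuous (X \+ Y : {linear H -> H}).
Proof. by move=> x; apply: cvgD; exact: bfun_continuous. Qed.

Fact bopD_adj (X Y : bop) x y :
  hdot ((X \+ Y : {linear H -> H}) x) y = hdot x (badj X y + badj Y y).
Proof. by rewrite /= hdotDl hdotDr !badjE. Qed.

Definition bopD (X Y : bop) : bop :=
  Bop (@bopD_continuous X Y) (@bopD_adj X Y).

Fact bopZ_continuous a (X : bop) : continuous (a \*: X : {linear H -> H}).
Proof. by move=> x; apply: cvgZr; exact: bfun_continuous. Qed.

Fact bopZ_adj a (X : bop) x y :
  hdot ((a \*: X : {linear H -> H}) x) y = hdot x (a^* *: badj X y).
Proof. by rewrite /= hdotZl hdotZr conjCK badjE. Qed.

Definition bopZ a (X : bop) : bop := Bop (@bopZ_continuous a X) (@bopZ_adj a X).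

Definition bopN := bopZ (-1).

Fact bcomp_continuous (X Y : bop) : continuous (X \o Y : {linear H -> H}).
Proof. by move=> x; apply: continuous_comp; exact: bfun_continuous. Qed.

Fact bcomp_adj (X Y : bop) x y :
  hdot ((X \o Y : {linear H -> H}) x) y = hdot x (badj Y (badj X y)).
Proof. by rewrite /= !badjE. Qed.

Definition bcomp (X Y : bop) : bop :=
  Bop (@bcomp_continuous X Y) (@bcomp_adj X Y).

Fact bopDA : associative bopD.
Proof. by move=> X Y Z; apply: bop_eq => x /=; rewrite addrA. Qed.
Fact bopDC : commutative bopD.
Proof. by move=> X Y; apply: bop_eq => x /=; rewrite addrC. Qed.
Fact bop0D : left_id bop0 bopD.
Proof. by move=> X; apply: bop_eq => x /=; rewrite add0r. Qed.
Fact bopND : left_inverse bop0 bopN bopD.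
Proof. by move=> X; apply: bop_eq => x /=; rewrite scaleN1r addNr. Qed.

HB.instance Definition _ := GRing.isZmodule.Build bop bopDA bopDC bop0D bopND.

Fact bopZA a b (X : bop) : bopZ a (bopZ b X) = bopZ (a * b) X.
Proof. by apply: bop_eq => x /=; rewrite scalerA. Qed.
Fact bop1Z : left_id 1 bopZ.
Proof. by move=> X; apply: bop_eq => x /=; rewrite scale1r. Qed.
Fact bopZDr : right_distributive bopZ +%R.
Proof. by move=> a X Y; apply: bop_eq => x /=; rewrite scalerDr. Qed.
Fact bopZDl (X : bop) : {morph bopZ^~ X : a b / a + b}.
Proof. by move=> a b; apply: bop_eq => x /=; rewrite scalerDl. Qed.

HB.instance Definition _ :=
  GRing.Zmodule_isLmodule.Build R[i] bop bopZA bop1Z bopZDr bopZDl.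

Lemma hdot_CauchySchwarz x y : `|hdot x y| <= `|x| * `|y|.
Proof.
have [->|y0] := eqVneq y 0; first by rewrite hdot0r !normr0 mulr0.
have ny : 0 < `|y| ^+ 2 by rewrite exprn_gt0 // normr_gt0.
pose a := hdot x y / `|y| ^+ 2.
have h : 0 <= hdot (x - a *: y) (x - a *: y) by rewrite hdot_norm exprn_ge0.
have h1 : hdot (x - a *: y) y = 0.
  by rewrite hdotDl hdotNl hdotZl (hdot_norm y) /a divfK ?subrr// gt_eqF.
rewrite hdotDr hdotNr hdotZr h1 mulr0 subr0 in h.
rewrite hdotDl hdotNl hdotZl hdot_norm (hdot_conj x y) in h.
rewrite /a mulrAC -normCK subr_ge0 ler_pdivrMr// -exprMn in h.
by rewrite -(@ler_pXn2r _ 2)// nnegrE// mulr_ge0.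
Qed.

Fact bstar_continuous (X : bop) :
  continuous (HB.pack_for {linear H -> H} (badj X)
    (GRing.isLinear.Build _ _ _ _ _ (badj_linear X))).
Proof.
apply: bounded_linear_continuous; apply/linear_boundedP.
have /linear_bounded_continuous/linear_boundedP := @bfun_continuous X.
apply: filterS => r hr y /=.
have [->|Xy0] := eqVneq (badj X y) 0.
  by rewrite normr0 (le_trans (normr_ge0 _) (hr y)).
rewrite -(@ler_pM2r _ `|badj X y|) ?normr_gt0// -expr2 -hdot_norm -badjE.
rewrite -[leLHS]ger0_norm; last by rewrite badjE hdot_norm exprn_ge0.
apply: (le_trans (hdot_CauchySchwarz _ _)).
by rewrite mulrAC ler_wpM2r.
Qed.

Definition bstar (X : bop) : bop := Bop (@bstar_continuous X) (badjEr X).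
End HilbertTheory.

Arguments bop0 {R H}.
Arguments bop1 {R H}.

Section Operators.
Variables (R : realType) (H : hilbert R).
Implicit Types (X Y Z : bop H) (S M : set (bop H)).

Definition opnorm_le X (k : R[i]) : Prop := forall x, `|X x| <= k * `|x|.

Definition unitary X : Prop :=
  bcomp (bstar X) X = bop1 /\ bcomp X (bstar X) = bop1.

Definition positive X : Prop := forall x, 0 <= hdot (X x) x.

Definition bop_le X Y : Prop := positive (Y - X).

Definition norm_closure S : set (bop H) :=
  [set Y | forall e : R[i], 0 < e -> exists2 X, S X & opnorm_le (Y - X) e].

Definition linear_span S : set (bop H) :=
  [set Y | exists (n : nat) (c : 'I_n -> R[i]) (X : 'I_n -> bop H),
     (forall i, S (X i)) /\ Y = \sum_(i < n) c i *: X i].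

Definition closed_span S := norm_closure (linear_span S).

Definition commutant S : set (bop H) :=
  [set Y | forall X, S X -> bcomp X Y = bcomp Y X].

Definition bicommutant S := commutant (commutant S).

Definition von_neumann M : Prop :=
  (forall X, M X -> M (bstar X)) /\ bicommutant M = M.

Definition compact_ops : set (bop H) :=
  closed_span [set X | exists x y, forall z, X z = hdot z y *: x].

(* For a norm-closed *-algebra S acting nondegenerately, this is M(S). *)
Definition multipliers S : set (bop H) :=
  [set Y | forall X, S X -> S (bcomp Y X) /\ S (bcomp X Y)].

(* The elements of B(H)_* are the functionals
   X |-> \sum_n <X (xi n), eta n> with xi, eta square summable. *)
Record l2seq := L2seq {
  l2val :> nat -> H;
  l2P : exists k : R[i], forall n, \sum_(i < n) `|l2val i| ^+ 2 <= k }.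

Record predual := Predual { pre_l : l2seq; pre_r : l2seq }.

Definition pre_sum (w : predual) (f : H -> H -> R[i]) : R[i] :=
  limn (fun n => \sum_(i < n) f (pre_l w i) (pre_r w i) : R[i]^o).

Definition pre_app (w : predual) X : R[i] := pre_sum w (fun x y => hdot (X x) y).

Definition pre_positive M (w : predual) : Prop :=
  forall X, M X -> 0 <= pre_app w (bcomp (bstar X) X).

End Operators.

Definition normal_on (R : realType) (H K : hilbert R) (M : set (bop H))
    (f : bop H -> bop K) : Prop :=
  forall w : predual K, exists w' : predual H,
    forall X, M X -> pre_app w' X = pre_app w (f X).

Definition star_hom (R : realType) (V W : lmodType R[i]) (D : set V)
    (mV : V -> V -> V) (sV : V -> V) (mW : W -> W -> W) (sW : W -> W)
    (f : V -> W) : Prop :=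
  [/\ forall (a : R[i]) x y, D x -> D y -> f (a *: x + y) = a *: f x + f y,
      forall x y, D x -> D y -> f (mV x y) = mW (f x) (f y)
    & forall x, D x -> f (sV x) = sW (f x)].

(* Determined by H and K up to a unique unitary fixing simple tensors. *)
Record htensor (R : realType) (H K : hilbert R) := HTensor {
  ht_space :> hilbert R;
  ht_tens : H -> K -> ht_space;
  ht_dot : forall x y x' y',
    hdot (ht_tens x y) (ht_tens x' y') = hdot x x' * hdot y y';
  ht_total : forall z, (forall x y, hdot (ht_tens x y) z = 0) -> z = 0 }.

Record cstar (R : realType) := CStar {
  cspace :> completeNormedModType R[i];
  cmul : cspace -> cspace -> cspace;
  cadj : cspace -> cspace;
  cmulA : associative cmul;
  cmul_linearl : forall y, linear (cmul^~ y);
  cmul_linearr : forall x, linear (cmul x);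
  cadj_conj_linear : forall (a : R[i]) x y,
    cadj (a *: x + y) = a^* *: cadj x + cadj y;
  cadjK : involutive cadj;
  cadjM : forall x y, cadj (cmul x y) = cmul (cadj y) (cadj x);
  cnormM : forall x y, `|cmul x y| <= `|x| * `|y|;
  cnorm_adj : forall x, `|cmul (cadj x) x| = `|x| ^+ 2 }.

Section CStarTheory.
Variables (R : realType) (A : cstar R).

Definition is_unit (e : A) : Prop :=
  forall a : A, cmul e a = a /\ cmul a e = a.

Definition unital : Prop := exists2 e : A, e != 0 & is_unit e.

Record dual := Dual {
  dual_fun :> {linear A -> R[i]^o};
  dual_continuous : continuous dual_fun }.

Definition dual_positive (mu : dual) : Prop :=
  forall a : A, 0 <= (mu (cmul (cadj a) a) : R[i]).

Definition dual_norm_le (mu : dual) (k : R[i]) : Prop :=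
  forall a : A, `|mu a : R[i]| <= k * `|a|.

Definition state (mu : dual) : Prop :=
  [/\ dual_positive mu, dual_norm_le mu 1
    & forall k, dual_norm_le mu k -> 1 <= k].

Definition vector_functional (H : hilbert R) (f : A -> bop H) (xi eta : H)
    (mu : dual) : Prop :=
  forall a, (mu a : R[i]) = hdot (f a xi) eta.

Definition cstar_rep (H : hilbert R) (f : A -> bop H) : Prop :=
  star_hom setT (@cmul R A) (@cadj R A) (@bcomp R H) (@bstar R H) f.

Definition isometric (H : hilbert R) (f : A -> bop H) : Prop :=
  forall (a : A) (k : R[i]), 0 <= k -> opnorm_le (f a) k <-> `|a| <= k.

End CStarTheory.

(* In such a representation the bicommutant of A, with its normal functionals,
   is A** with its weak-* topology, and A* is the set of vector functionals. *)
Record univrep (R : realType) (A : cstar R) := UnivRep {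
  ur_space :> hilbert R;
  ur_map : A -> bop ur_space;
  ur_rep : cstar_rep ur_map;
  ur_isometric : isometric ur_map;
  ur_nondegenerate :
    forall z, (forall a x, hdot (ur_map a x) z = 0) -> z = 0;
  ur_positive : forall mu : dual A, dual_positive mu ->
    exists xi, vector_functional ur_map xi xi mu;
  ur_functional : forall mu : dual A,
    exists xi eta, vector_functional ur_map xi eta mu }.

Section QuantumGroups.
Variables (R : realType).
(* A choice of Hilbert space tensor product of any two Hilbert spaces, and of
   universal representation of any C*-algebra. *)
Variable tens : forall H K : hilbert R, htensor H K.
Variable univ : forall A : cstar R, univrep A.

Local Notation "H \OT K" := (ht_space (tens H K))
  (at level 40, left associativity).
Local Notation "x \ot y" := (ht_tens (tens _ _) x y)
  (at level 40, left associativity).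
Local Notation "X ** Y" := (bcomp X Y) (at level 40, left associativity).
Local Notation "X ^*o" := (bstar X) (at level 2, format "X ^*o").

Section Tensors.
Variables H K : hilbert R.

Definition simple_tensors (M : set (bop H)) (N : set (bop K))
    : set (bop (H \OT K)) :=
  [set Z | exists X Y, [/\ M X, N Y
    & forall x y, Z (x \ot y) = X x \ot Y y]].

Definition vn_tensor M N := bicommutant (simple_tensors M N).

Definition min_tensor M N := closed_span (simple_tensors M N).

(* S = (id (x) w)(X) and S = (w (x) id)(X) *)
Definition rslice (X : bop (H \OT K)) (w : predual K) (S : bop H) : Prop :=
  forall x y, hdot (S x) y = pre_sum w (fun u v => hdot (X (x \ot u)) (y \ot v)).

Definition lslice (X : bop (H \OT K)) (w : predual H) (S : bop K) : Prop :=
  forall x y, hdot (S x) y = pre_sum w (fun u v => hdot (X (u \ot x)) (v \ot y)).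

Definition leg13 (U : bop (H \OT K)) (Y : bop ((H \OT H) \OT K)) : Prop :=
  forall x y z x' y' z', hdot (Y ((x \ot y) \ot z)) ((x' \ot y') \ot z') =
    hdot y y' * hdot (U (x \ot z)) (x' \ot z').

Definition leg23 (U : bop (H \OT K)) (Y : bop ((H \OT H) \OT K)) : Prop :=
  forall x y z x' y' z', hdot (Y ((x \ot y) \ot z)) ((x' \ot y') \ot z') =
    hdot x x' * hdot (U (y \ot z)) (y' \ot z').

End Tensors.

Definition reg (A : cstar R) : A -> bop (univ A) := ur_map (univ A).

Definition concrete (A : cstar R) : set (bop (univ A)) := range (@reg A).
Arguments concrete : clear implicits.

Definition bidual (A : cstar R) : set (bop (univ A)) :=
  bicommutant (concrete A).
Arguments bidual : clear implicits.

(* eb_conv and eb_act are determined by their specifications: <Phi(a), mu (x) nu>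
   is computed with vectors implementing mu and nu, and eb_act mu is
   (mu (x) id)(V). *)
Record eberlein (A : cstar R) (H : hilbert R) := Eberlein {
  eb_Phi : A -> bop (univ A \OT univ A);
  eb_Phi_in : forall a, vn_tensor (bidual A) (bidual A) (eb_Phi a);
  eb_Phi_hom : cstar_rep eb_Phi;
  eb_Phi_unit : forall e : A, is_unit e -> eb_Phi e = bop1;
  eb_Phi_nonunital : ~ (exists e : A, is_unit e) ->
    exists F : bop (univ A) -> bop (univ A \OT univ A),
      [/\ star_hom (bidual A) (@bcomp R (univ A)) (@bstar R (univ A))
            (@bcomp R (univ A \OT univ A)) (@bstar R (univ A \OT univ A)) F,
          normal_on (bidual A) F, forall a, F (reg a) = eb_Phi a
        & F bop1 = bop1];
  eb_V : bop (univ A \OT H);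
  eb_V_in : vn_tensor (bidual A) [set: bop H] eb_V;
  eb_V_contraction : opnorm_le eb_V 1;
  eb_slice_sub : forall w : predual H, exists a : A, rslice eb_V w (reg a);
  eb_slice_dense : forall (a : A) (e : R[i]), 0 < e ->
    exists (w : predual H) (b : A), rslice eb_V w (reg b) /\ `|a - b| < e;
  eb_conv : dual A -> dual A -> dual A;
  eb_convE : forall (mu nu : dual A) (xi eta xi' eta' : univ A),
    vector_functional (@reg A) xi eta mu ->
    vector_functional (@reg A) xi' eta' nu ->
    forall a, (eb_conv mu nu a : R[i]) =
      hdot (eb_Phi a (xi \ot xi')) (eta \ot eta');
  eb_convA : associative eb_conv;
  eb_act : dual A -> bop H;
  eb_actE : forall (mu : dual A) (xi eta : univ A),
    vector_functional (@reg A) xi eta mu ->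
    forall x y, hdot (eb_act mu x) y = hdot (eb_V (xi \ot x)) (eta \ot y);
  eb_act_hom : forall mu nu, eb_act (eb_conv mu nu) = eb_act mu ** eb_act nu }.

Section InvariantMean.
Variables (A : cstar R) (H : hilbert R) (E : eberlein A H).

(* a . mu (and dually mu . a) lies in A; xget picks the unique element of A with
   the defining pairing. *)
Definition eb_rmod (a : A) (mu : dual A) : A :=
  xget 0 [set b | forall lam : dual A, lam b = eb_conv E mu lam a].

Definition eb_lmod (mu : dual A) (a : A) : A :=
  xget 0 [set b | forall lam : dual A, lam b = eb_conv E lam mu a].

Definition invariant_mean (M : dual A) : Prop :=
  state M /\ forall mu : dual A, state mu -> forall a : A,
    M (eb_rmod a mu) = M a /\ M a = M (eb_lmod mu a).

End InvariantMean.

Section Weights.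
Variables (H : hilbert R) (M : set (bop H)).

Definition pos_part : set (bop H) := [set X | M X /\ positive X].

Definition sq_integrable (phi : bop H -> \bar R) : set (bop H) :=
  [set X | M X /\ (phi (X^*o ** X) < +oo)%E].

Record nsf_weight (phi : bop H -> \bar R) : Prop := {
  wt_ge0 : forall X, pos_part X -> (0 <= phi X)%E;
  wt_add : forall X Y, pos_part X -> pos_part Y ->
    phi (X + Y) = (phi X + phi Y)%E;
  wt_scale : forall (c : R) X, 0 <= c -> pos_part X ->
    phi (c%:C *: X) = (c%:E * phi X)%E;
  wt_normal : forall (D : set (bop H)) X,
    D !=set0 -> D `<=` pos_part -> pos_part X ->
    (forall Y Z, D Y -> D Z -> exists T, [/\ D T, bop_le Y T & bop_le Z T]) ->
    (forall Y, D Y -> bop_le Y X) ->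
    (forall T, pos_part T -> (forall Y, D Y -> bop_le Y T) -> bop_le X T) ->
    phi X = ereal_sup (phi @` D);
  (* sigma-weak density of the square integrable elements *)
  wt_semifinite : forall (X : bop H) (k : nat) (w : 'I_k -> predual H) (e : R[i]),
    M X -> 0 < e -> exists2 Y, sq_integrable phi Y
      & forall i, `|pre_app (w i) (X - Y)| < e;
  wt_faithful : forall X, pos_part X -> phi X = 0%E -> X = 0 }.

End Weights.

(* A von Neumann algebra M with a normal coassociative coproduct and left and
   right invariant weights, acting on L^2(G), the GNS space of the left weight. *)
Record lcqg := Lcqg {
  qg_L2 : hilbert R;
  qg_M : set (bop qg_L2);
  qg_vn : von_neumann qg_M;
  qg_D : bop qg_L2 -> bop (qg_L2 \OT qg_L2);
  qg_D_in : forall X, qg_M X -> vn_tensor qg_M qg_M (qg_D X);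
  qg_D_hom : star_hom qg_M (@bcomp R _) (@bstar R _) (@bcomp R _) (@bstar R _) qg_D;
  qg_D_unit : qg_D bop1 = bop1;
  qg_D_normal : normal_on qg_M qg_D;
  (* YL = (D (x) id)(D X) and YR = (id (x) D)(D X) *)
  qg_coassoc : forall X, qg_M X ->
    exists (YL : bop ((qg_L2 \OT qg_L2) \OT qg_L2))
           (YR : bop (qg_L2 \OT (qg_L2 \OT qg_L2))),
      [/\ forall w S, rslice (qg_D X) w S -> rslice YL w (qg_D S),
          forall w S, lslice (qg_D X) w S -> lslice YR w (qg_D S)
        & forall x y z x' y' z',
            hdot (YL ((x \ot y) \ot z)) ((x' \ot y') \ot z') =
            hdot (YR (x \ot (y \ot z))) (x' \ot (y' \ot z'))];
  qg_phi : bop qg_L2 -> \bar R;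
  qg_psi : bop qg_L2 -> \bar R;
  qg_phi_nsf : nsf_weight qg_M qg_phi;
  qg_psi_nsf : nsf_weight qg_M qg_psi;
  qg_left_inv : forall w X S, pre_positive qg_M w -> pos_part qg_M X ->
    (qg_phi X < +oo)%E -> lslice (qg_D X) w S ->
    qg_phi S = ((complex.Re (pre_app w bop1))%:E * qg_phi X)%E;
  qg_right_inv : forall w X S, pre_positive qg_M w -> pos_part qg_M X ->
    (qg_psi X < +oo)%E -> rslice (qg_D X) w S ->
    qg_psi S = ((complex.Re (pre_app w bop1))%:E * qg_psi X)%E;
  qg_Lambda : bop qg_L2 -> qg_L2;
  qg_Lambda_linear : forall (a : R[i]) X Y,
    sq_integrable qg_M qg_phi X -> sq_integrable qg_M qg_phi Y ->
    qg_Lambda (a *: X + Y) = a *: qg_Lambda X + qg_Lambda Y;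
  qg_Lambda_norm : forall X, sq_integrable qg_M qg_phi X ->
    qg_phi (X^*o ** X) = (complex.Re (`|qg_Lambda X| ^+ 2))%:E;
  qg_Lambda_mul : forall X Y, qg_M X -> sq_integrable qg_M qg_phi Y ->
    qg_Lambda (X ** Y) = X (qg_Lambda Y);
  qg_Lambda_dense : forall (x : qg_L2) (e : R[i]), 0 < e ->
    exists2 X, sq_integrable qg_M qg_phi X & `|x - qg_Lambda X| < e }.

Arguments qg_M : clear implicits.
Arguments qg_D : clear implicits.
Arguments qg_phi : clear implicits.
Arguments qg_psi : clear implicits.
Arguments qg_Lambda : clear implicits.

(* The Kac-Takesaki operator:
   (w (x) id)(W^* ) Lambda(X) = Lambda((w (x) id) Delta(X)). *)
Definition kac_takesaki (G : lcqg) (W : bop (qg_L2 G \OT qg_L2 G)) : Prop :=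
  unitary W /\
  forall w X S T, sq_integrable (qg_M G) (qg_phi G) X ->
    lslice (qg_D G X) w S -> lslice (W^*o) w T ->
    T (qg_Lambda G X) = qg_Lambda G S.

(* The dual has Kac-Takesaki operator Sigma W^* Sigma, whence its (injective)
   regular representation w |-> (id (x) w)(W^* ) on L^1 of the dual; L^1_sharp of
   the dual consists of the w such that ((id (x) w)(W^* ))^* is again in the
   image. It is identified with its image, a *-algebra of operators. *)
Definition dual_L1sharp (G : lcqg) (W : bop (qg_L2 G \OT qg_L2 G))
    : set (bop (qg_L2 G)) :=
  [set Y | exists w w', rslice (W^*o) w Y /\ rslice (W^*o) w' (Y^*o)].

Section Corepresentations.
Variables (A : cstar R) (D : A -> bop (univ A \OT univ A)).

(* Z is the image of the multiplier m under the strict extension of D. *)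
Definition mult_ext (m : bop (univ A)) (Z : bop (univ A \OT univ A)) : Prop :=
  forall a b : A, reg b = m ** reg a -> Z ** D a = D b.

(* Y = (D (x) id)(U) *)
Definition amplified (H : hilbert R) (U : bop (univ A \OT H))
    (Y : bop ((univ A \OT univ A) \OT H)) : Prop :=
  forall w m Z, rslice U w m -> rslice Y w Z -> mult_ext m Z.

Definition corepresentation (H : hilbert R) (U : bop (univ A \OT H)) : Prop :=
  [/\ unitary U,
      multipliers (min_tensor (concrete A) (compact_ops (H := H))) U
    & exists Y13 Y23,
        [/\ leg13 U Y13, leg23 U Y23 & amplified U (Y13 ** Y23)]].

End Corepresentations.

(* un_alg is the enveloping C*-algebra of L^1_sharp of the dual: un_norm and the
   existence of a faithful representation of un_alg make the norm of un_gen Y the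
   supremum of the norms of rho(Y) over all *-representations rho. The coproduct
   is determined by un_WW, the lift of W to un_alg. *)
Record universal_alg (G : lcqg) := UniversalAlg {
  un_W : bop (qg_L2 G \OT qg_L2 G);
  un_W_kt : kac_takesaki un_W;
  un_alg : cstar R;
  un_gen : bop (qg_L2 G) -> un_alg;
  un_gen_hom : star_hom (dual_L1sharp un_W) (@bcomp R _) (@bstar R _)
    (@cmul R un_alg) (@cadj R un_alg) un_gen;
  un_gen_dense : forall (a : un_alg) (e : R[i]), 0 < e ->
    exists2 Y, dual_L1sharp un_W Y & `|a - un_gen Y| < e;
  un_norm : forall (K : hilbert R) (rho : bop (qg_L2 G) -> bop K),
    star_hom (dual_L1sharp un_W) (@bcomp R _) (@bstar R _)
      (@bcomp R _) (@bstar R _) rho ->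
    forall Y, dual_L1sharp un_W Y -> opnorm_le (rho Y) `|un_gen Y|;
  un_D : un_alg -> bop (univ un_alg \OT univ un_alg);
  un_D_hom : cstar_rep un_D;
  un_D_in : forall a,
    multipliers (min_tensor (concrete un_alg) (concrete un_alg)) (un_D a);
  un_D_nondegenerate :
    closed_span [set Z | exists a X,
      min_tensor (concrete un_alg) (concrete un_alg) X /\ Z = un_D a ** X] =
    min_tensor (concrete un_alg) (concrete un_alg);
  un_WW : bop (univ un_alg \OT qg_L2 G);
  un_WW_corep : corepresentation un_D un_WW;
  un_WW_slice : forall w Y, dual_L1sharp un_W Y ->
    rslice (un_W^*o) w Y -> rslice (un_WW^*o) w (reg (un_gen Y));
  (* the product of C_0^u(G)^*; multipliers are paired with functionals through
     implementing vectors *)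
  un_conv : dual un_alg -> dual un_alg -> dual un_alg;
  un_convE : forall (mu nu : dual un_alg) (xi eta xi' eta' : univ un_alg),
    vector_functional (@reg un_alg) xi eta mu ->
    vector_functional (@reg un_alg) xi' eta' nu ->
    forall a, (un_conv mu nu a : R[i]) =
      hdot (un_D a (xi \ot xi')) (eta \ot eta') }.

Section Embedded.
Variables (G : lcqg) (C : universal_alg G).

Record embedded := Embedded {
  em_H : hilbert R;
  em_U : bop (univ (un_alg C) \OT em_H);
  em_corep : corepresentation (@un_D _ C) em_U;
  em_alg : cstar R;
  (* em_alg is the C*-algebra range em_inc, seen as an abstract C*-algebra *)
  em_inc : em_alg -> bop (univ (un_alg C));
  em_inc_hom : cstar_rep em_inc;
  em_inc_isometric : isometric em_inc;
  em_inc_mult : range em_inc `<=` multipliers (concrete (un_alg C));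
  em_range : range em_inc =
    norm_closure [set S | exists w, rslice em_U w S];
  em_eb : eberlein em_alg em_H;
  em_V : forall w b, rslice em_U w (em_inc b) -> rslice (eb_V em_eb) w (reg b);
  em_res : dual (un_alg C) -> dual em_alg;
  em_resE : forall mu xi eta, vector_functional (@reg (un_alg C)) xi eta mu ->
    vector_functional em_inc xi eta (em_res mu);
  em_res_hom : forall mu nu,
    em_res (un_conv mu nu) = eb_conv em_eb (em_res mu) (em_res nu) }.

Definition is_EG (E : embedded) : Prop :=
  unital (em_alg E) /\
  forall F : embedded, unital (em_alg F) ->
    range (@em_inc F) `<=` range (@em_inc E).

End Embedded.
End QuantumGroups.

(* Main.v *)
From HB Require Import structures.
Require Import Defs.
From mathcomp Require Import all_boot all_order all_algebra.
From mathcomp Require Import complex ring lra.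
From mathcomp Require Import all_classical all_reals all_analysis.

(* A state mu acts on H as the contraction s_mu = (mu (x) id)(V), and these
   operators form a convex semigroup. By the Alaoglu-Birkhoff mean ergodic
   theorem its strong closure contains the projection p onto the common fixed
   vectors, and s_mu p = p = p s_mu. A weak-* limit M of states with s_mu -> p
   satisfies s_M = p; as the coefficients of V are dense, this gives
   mu * M = M = M * mu, that is, M is an invariant mean. If N is another one,
   then M = M * N = N. *)

Set Implicit Arguments.
Unset Strict Implicit.
Unset Printing Implicit Defensive.

Import Order.TTheory GRing.Theory Num.Theory numFieldNormedType.Exports.
Local Open Scope classical_set_scope.
Local Open Scope ring_scope.
Local Open Scope complex_scope.

(** * Complex scalars and convergence in norm *)

Lemma gt0_ReP (R : realType) (e : R[i]) :
  0 < e -> 0 < complex.Re e /\ e = (complex.Re e)%:C.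
Proof.
move=> e0; have eE : e = (complex.Re e)%:C by rewrite RRe_real ?gtr0_real.
by split=> //; rewrite -ltcR -eE.
Qed.

Lemma natSinv_lt (R : realType) (e : R[i]) : 0 < e ->
  exists N, forall n, (N <= n)%N -> n.+1%:R^-1 < e.
Proof.
move=> /gt0_ReP[e0 ->].
have [N _ hN] := near_infty_natSinv_lt (PosNum e0).
exists N => n Nn; have := hN n Nn; rewrite /= -ltcR.
by rewrite fmorphV rmorph_nat.
Qed.

Lemma norm_cauchy_cvgn (R : realType) (V : completeNormedModType R[i])
    (u : nat -> V) :
  (forall e, 0 < e -> exists N, forall n m, (N <= n)%N -> (N <= m)%N ->
    `|u n - u m| < e) -> cvgn u.
Proof.
move=> h; apply: cauchy_cvg; apply/cauchy_ballP => e e0.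
have [N hN] := h e e0.
exists (u @` [set n | (N <= n)%N], u @` [set n | (N <= n)%N]) => /=.
  by split; exists N => // n Nn; exists n.
by move=> [_ _] [/= [n Nn <-] [m Nm <-]]; rewrite -ball_normE; exact: hN.
Qed.

Lemma norm_lt_eq0 (K : numDomainType) (V : normedZmodType K) (x : V) :
  (forall e : K, 0 < e -> `|x| < e) -> x = 0.
Proof.
move=> h; apply/eqP; rewrite -normr_eq0; apply/negPn/negP => x0.
by have := h `|x|; rewrite lt_def x0 normr_ge0 ltxx => /(_ isT).
Qed.

(** * The Alaoglu-Birkhoff mean ergodic theorem on a Hilbert space *)

Section AlaogluBirkhoff.
Variables (R : realType) (H : hilbert R).
Implicit Types (x y z : H) (X Y Z : bop H) (S : set (bop H)).

(** Norms take values in [R[i]]; a real-valued square gives access to infima and to linear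
    arithmetic over [R]. *)
Definition sqn x : R := complex.Re (`|x| ^+ 2).

Lemma sqnE x : `|x| ^+ 2 = (sqn x)%:C.
Proof. by rewrite /sqn RRe_real// realX// normr_real. Qed.

Lemma sqn_ge0 x : 0 <= sqn x.
Proof. by rewrite -ler0c -sqnE exprn_ge0. Qed.

Lemma norm_lt_sqn x (e : R) : 0 < e -> (`|x| < e%:C) = (sqn x < e ^+ 2).
Proof.
move=> e0; have e0c : 0 <= e%:C by rewrite ler0c ltW.
rewrite -(@ltr_pXn2r _ 2)// ?nnegrE//.
by rewrite sqnE -rmorphXn /= ltcR.
Qed.

Lemma norm_le_sqn x y : (`|x| <= `|y|) = (sqn x <= sqn y).
Proof. by rewrite -(@ler_pXn2r _ 2)// ?nnegrE// !sqnE lecR. Qed.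

(** The sum is written as a midpoint because midpoints of an orbit stay in the orbit, which bounds
    the last term below. *)
Lemma parallelogram x y :
  sqn (x - y) = 2 * sqn x + 2 * sqn y - 4 * sqn (2^-1 *: (x + y)).
Proof.
apply: complexI; rewrite rmorphB rmorphD !rmorphM !rmorph_nat /= -!sqnE.
rewrite normrZ exprMn normfV ger0_norm// -!hdot_norm.
rewrite !(hdotDl, hdotDr, hdotNl, hdotNr).
by field.
Qed.

Definition contraction_semigroup S : Prop :=
  [/\ S !=set0, forall X Y, S X -> S Y -> S (2^-1 *: (X + Y)),
      forall X Y, S X -> S Y -> S (bcomp X Y)
    & forall X, S X -> opnorm_le X 1].

Definition orbit_closure S x y : Prop :=
  forall e : R[i], 0 < e -> exists2 X, S X & `|X x - y| < e.

Lemma contractionP S X x : contraction_semigroup S -> S X -> `|X x| <= `|x|.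
Proof. by case=> _ _ _ h SX; have := h X SX x; rewrite mul1r. Qed.

(* The fixed point is the element of minimal norm in the orbit closure. *)
Lemma exists_fixed_point S x : contraction_semigroup S ->
  exists y, orbit_closure S x y /\ forall X, S X -> X y = y.
Proof.
move=> hS; have [S0 Sc Sm _] := hS.
pose D := [set sqn (X x) | X in S]; pose d := inf D.
have Dinf : has_inf D.
  split; first by have [X SX] := S0; exists (sqn (X x)), X.
  by exists 0 => _ [X SX <-]; exact: sqn_ge0.
have dle X : S X -> d <= sqn (X x).
  by move=> SX; apply: ge_inf; [case: Dinf|exists X].
(* The midpoint has squared norm at least [d], so the parallelogram law leaves less than 2(d + e) +
   2(d + e) - 4d = 4e. *)
have near X Y e : S X -> S Y -> sqn (X x) < d + e -> sqn (Y x) < d + e ->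
    sqn (X x - Y x) < 4 * e.
  move=> SX SY hX hY; rewrite parallelogram.
  have := dle _ (Sc _ _ SX SY) => /=; lra.
have /choice[X hX] : forall n : nat, exists X,
    S X /\ sqn (X x) < d + n.+1%:R^-1.
  move=> n; have n0 : 0 < n.+1%:R^-1 :> R by rewrite invr_gt0.
  by have [_ [X SX <-] hX] := inf_adherent n0 Dinf; exists X.
(* Any nearly minimal [Y x] is close to the tail of the minimizing sequence. With [Y] taken from the
   sequence this is the Cauchy property; with [Y] = [T] after [X n] it shows that [T] fixes the
   limit. *)
have small e : 0 < e -> exists N, forall n Y, (N <= n)%N -> S Y ->
    sqn (Y x) < d + n.+1%:R^-1 -> forall m, (n <= m)%N -> `|X m x - Y x| < e.
  move=> /gt0_ReP[e0 ->]; set r := complex.Re e in e0 *.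
  have r0 : 0 < r ^+ 2 / 4 by rewrite divr_gt0// exprn_gt0.
  have [N _ hN] := near_infty_natSinv_lt (PosNum r0).
  exists N => n Y Nn SY hY m nm; rewrite norm_lt_sqn//.
  have := hN n Nn => /= hn.
  have lmn : m.+1%:R^-1 <= n.+1%:R^-1 :> R.
    by rewrite lef_pV2 ?posrE// ler_nat.
  have [SXm hXm] := hX m.
  have hXm' : sqn (X m x) < d + n.+1%:R^-1.
    by rewrite (lt_le_trans hXm)// lerD2l.
  rewrite (lt_trans (near _ _ _ SXm SY hXm' hY))// mulrC.
  by rewrite -ltr_pdivlMr.
have /cvg_ex[y Xy] : cvgn (fun n => X n x).
  apply: norm_cauchy_cvgn => e /small[N hN]; exists N => n m Nn Nm.
  have [nm|/ltnW mn] := leqP n m.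
    by rewrite distrC; have [? ?] := hX n; exact: (hN n).
  by have [? ?] := hX m; exact: (hN m).
have lim e : 0 < e -> exists N, forall n, (N <= n)%N -> `|X n x - y| < e.
  move=> e0; have /cvgr_distC_lt/(_ e e0)[N _ hN] := Xy.
  by exists N.
exists y; split.
  by move=> e /lim[N hN]; exists (X N); [case: (hX N)|exact: hN].
move=> T ST; apply/eqP; rewrite -subr_eq0; apply/eqP.
apply: norm_lt_eq0 => e e0.
(* [T y - y] is split into three terms, each of norm below [e / 4]. *)
have e4 : 0 < e / 4 by rewrite divr_gt0.
have [N1 hN1] := lim _ e4; have [N2 hN2] := small _ e4.
set n := maxn N1 N2.
have h1 := hN1 n (leq_maxl _ _).
have [Sn hn] := hX n.
have h2 : `|X n x - T (X n x)| < e / 4.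
  apply: (hN2 n (bcomp T (X n)) (leq_maxr _ _) (Sm _ _ ST Sn) _ n (leqnn _)).
  by apply: le_lt_trans hn; rewrite -norm_le_sqn (contractionP _ hS ST).
have h3 : `|T (X n x - y)| < e / 4.
  by rewrite (le_lt_trans (contractionP _ hS ST)).
have -> : T y - y = - T (X n x - y) - (X n x - T (X n x)) + (X n x - y).
  by rewrite linearB /= !opprB !subrKA.
apply: (le_lt_trans (ler_normD _ _)).
apply: (@lt_le_trans _ _ (e / 4 + e / 4 + e / 4)).
  rewrite ltrD// (le_lt_trans (ler_normB _ _))// normrN ltrD//.
rewrite -!mulrDl ler_pdivrMr// -[X in _ <= X * _]mulr1.
rewrite -subr_ge0; have -> : e * 1 * 4 - (e + e + e) = e by ring.
exact: ltW.
Qed.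

(* The adjoint of X fixes y as well: |X^* y - y|^2 = |X^* y|^2 - |y|^2 <= 0. *)
Lemma fixed_hdot X x y : opnorm_le X 1 -> X y = y -> hdot (X x) y = hdot x y.
Proof.
move=> hX Xy; rewrite badjE; set w := badj X y.
have wy : hdot w y = `|y| ^+ 2 by rewrite badjEr Xy hdot_norm.
have yw : hdot y w = `|y| ^+ 2 by rewrite -badjE Xy hdot_norm.
have le_wy : `|w| <= `|y|.
  have [->|w0] := eqVneq w 0; first by rewrite normr0.
  rewrite -(@ler_pM2l _ `|w|) ?normr_gt0// -expr2 -hdot_norm -badjE.
  rewrite -[leLHS]ger0_norm; last by rewrite badjE hdot_norm exprn_ge0.
  apply: le_trans (hdot_CauchySchwarz _ _) _; rewrite ler_wpM2r//.
  by have := hX w; rewrite mul1r.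
suff /eqP : w - y = 0 by rewrite subr_eq0 => /eqP->.
apply/eqP; rewrite -normr_eq0 -sqrf_eq0 eq_le exprn_ge0// andbT.
rewrite -hdot_norm hdotDl !hdotDr !hdotNl !hdotNr wy yw !hdot_norm.
by rewrite opprK addNr addr0 subr_le0 ler_pXn2r// nnegrE.
Qed.

(** Every point of the orbit closure has the same inner product as [x] with each fixed vector, so
    [y - y'] is orthogonal to both [y] and [y']. *)
Lemma fixed_point_unique S x y y' :
  (forall X, S X -> opnorm_le X 1) ->
  orbit_closure S x y -> (forall X, S X -> X y = y) ->
  orbit_closure S x y' -> (forall X, S X -> X y' = y') -> y = y'.
Proof.
move=> hS.
have hdot_closure u z : orbit_closure S x u -> (forall X, S X -> X z = z) ->
    hdot u z = hdot x z.
  move=> xu hz; apply/eqP; rewrite -subr_eq0; apply/eqP.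
  apply: norm_lt_eq0 => e e0.
  (* The added 1 keeps the divisor positive when [z] is 0. *)
  have z0 : 0 < `|z| + 1 by rewrite ltr_wpDl.
  have [X SX hX] := xu _ (divr_gt0 e0 z0).
  rewrite -(fixed_hdot x (hS _ SX) (hz _ SX)) -hdotNl -hdotDl.
  apply: le_lt_trans (hdot_CauchySchwarz _ _) _.
  apply: (@le_lt_trans _ _ (`|X x - u| * (`|z| + 1))).
    by rewrite distrC ler_wpM2l// lerDl.
  by rewrite -ltr_pdivlMr.
move=> xy fy xy' fy'; apply/eqP; rewrite -subr_eq0 -normr_eq0 -sqrf_eq0.
rewrite -hdot_norm hdotDr hdotNr !hdotDl !hdotNl.
rewrite (hdot_closure _ _ xy fy) (hdot_closure _ _ xy fy').
by rewrite (hdot_closure _ _ xy' fy) (hdot_closure _ _ xy' fy') !subrr.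
Qed.

(** The last clause says that [p] is in the strong closure of [S]: finitely many vectors are
    approximated by one operator. *)
Lemma alaoglu_birkhoff S : contraction_semigroup S ->
  exists p : H -> H, [/\ forall X x, S X -> X (p x) = p x,
    forall X x, S X -> p (X x) = p x
    & forall (s : seq H) (e : R[i]), 0 < e ->
        exists2 X, S X & forall x, x \in s -> `|X x - p x| < e].
Proof.
move=> hS; have [S0 _ Sm Sle] := hS.
have /choice[p hp] : forall x, exists y,
  orbit_closure S x y /\ forall X, S X -> X y = y.
  by move=> x; exact: exists_fixed_point.
have pX X x : S X -> p (X x) = p x.
  move=> SX; apply: (@fixed_point_unique S x) => //; try by case: (hp x).
    (* The orbit of [X x] lies in the orbit of [x], so [p (X x)] is also a fixed point in the orbit
       closure of [x]. *)
    by move=> e /((hp (X x)).1)[Y SY hY]; exists (bcomp Y X) => //; exact: Sm.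
  by case: (hp (X x)).
exists p; split=> [X x SX||s e e0]; [exact: (hp x).2|exact: pX|].
(* Given [X] good on [s], choose [Y] moving [X x] close to [p (X x) = p x]. The contraction [Y]
   fixes each [p z], so composing with it does not spoil the earlier estimates. *)
elim: s => [|x s [X SX hX]]; first by have [X SX] := S0; exists X.
have [Y SY hY] := (hp (X x)).1 e e0.
exists (bcomp Y X); first exact: Sm.
move=> z; rewrite inE => /predU1P[->|zs] /=; first by rewrite -(pX _ _ SX).
rewrite -[X in _ - X]((hp z).2 _ SY) -linearB (le_lt_trans _ (hX z zs))//.
exact: contractionP hS SY.
Qed.
End AlaogluBirkhoff.

(** * Limits of bounded scalar functions along ultrafilters *)

Section UltraLimits.
Variables (R : realType) (T : Type).
Implicit Types (F : set_system T).

(** Compactness of [[-k, k]] gives a cluster point, and a cluster point of an ultrafilter is a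
    limit. *)
Lemma ultra_cvg_real F (f : T -> R) (k : R) : UltraFilter F ->
  (\forall t \near F, `|f t| <= k) -> exists l : R, f t @[t --> F] --> l.
Proof.
move=> UF hf; have Ff : (f t @[t --> F]) `[- k, k]%classic.
  by apply: filterS hf => t /=; rewrite in_itv /= -ler_norml.
have [l [_ hl]] := segment_compact _ Ff.
exists l => B nB; have [//|nFB] := in_ultra_setVsetC (f @^-1` B) UF.
by have [z [nz /nz//]] := hl (~` B) B nFB nB.
Qed.

Lemma norm_le_ReIm (z : R[i]) :
  `|z| <= (`|complex.Re z| + `|complex.Im z|)%:C.
Proof.
rewrite [in leLHS](complexE z) (le_trans (ler_normD _ _))//.
rewrite normrM !normc_def /= !expr0n /= expr1n !add0r !addr0 !sqrtr_sqr sqrtr1.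
by rewrite mul1r rmorphD.
Qed.

Lemma ultra_cvg_complex F (f : T -> R[i]) (k : R[i]) : UltraFilter F ->
  (\forall t \near F, `|f t| <= k) ->
  exists l : (R[i])^o, (f t : (R[i])^o) @[t --> F] --> l.
Proof.
move=> UF hf.
have [a fa] : exists l : R, complex.Re (f t) @[t --> F] --> l.
  apply: (@ultra_cvg_real _ _ (complex.Re k)) => //.
  apply: filterS hf => t; move=> /(le_trans (normc_ge_Re _)).
  by rewrite lecE => /andP[_].
have [b fb] : exists l : R, complex.Im (f t) @[t --> F] --> l.
  apply: (@ultra_cvg_real _ _ (complex.Re k)) => //.
  apply: filterS hf => t; move=> hf.
  (* The imaginary part of a number is minus the real part of its product with ['i], which reduces
     the bound to the one for real parts. *)
  have : `|complex.Re (f t * 'i)|%:C <= k.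
    rewrite (le_trans (normc_ge_Re _))// normrM [X in _ * X]normc_def /=.
    by rewrite expr0n expr1n add0r sqrtr1 mulr1.
  by rewrite ReiNIm normrN lecE => /andP[_].
exists (a +i* b); apply/cvgrPdist_lt => e /gt0_ReP[e0 ->].
have e2 : 0 < complex.Re e / 2 by rewrite divr_gt0.
near=> t.
have ha : `|a - complex.Re (f t)| < complex.Re e / 2.
  by near: t; exact: (cvgrPdist_lt _ _).1 fa _ e2.
have hb : `|b - complex.Im (f t)| < complex.Re e / 2.
  by near: t; exact: (cvgrPdist_lt _ _).1 fb _ e2.
rewrite (le_lt_trans (norm_le_ReIm _))// ltcR.
case: (f t) ha hb => u v /= ha hb; lra.
Unshelve. all: by end_near. Qed.

Lemma cvg_eq_complex F {PF : ProperFilter F} (f g : T -> (R[i])^o)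
    (k l : (R[i])^o) :
  (\forall t \near F, f t = g t) ->
  f t @[t --> F] --> k -> g t @[t --> F] --> l -> k = l.
Proof.
move=> fg fk gl; apply: (@cvg_unique _ (@norm_hausdorff _ _) _ _ _ _ fk).
by rewrite /=; apply: cvg_trans gl; apply: near_eq_cvg; apply: filterS fg.
Qed.

(** The order of [R[i]] makes nonnegative numbers real, so the limit must be shown to have zero
    imaginary part as well as nonnegative real part. *)
Lemma cvg_ge0_complex F {PF : ProperFilter F} (f : T -> R[i]) (l : (R[i])^o) :
  (f t : (R[i])^o) @[t --> F] --> l -> (\forall t \near F, 0 <= f t) ->
  0 <= (l : R[i]).
Proof.
move=> fl f0.
have near (e : R) : 0 < e -> exists2 z : R[i], 0 <= z & `|l - z| < e%:C.
  move=> e0; have e0' : 0 < e%:C by rewrite ltcR.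
  have hfl : \forall t \near F, `|l - f t| < e%:C.
    exact: (cvgrPdist_lt _ _).1 fl _ e0'.
  have [t [ft0 hft]] := @filter_ex _ F PF _ (filterI f0 hfl).
  by exists (f t).
have hRe (z : R[i]) (e : R) : `|z| < e%:C -> `|complex.Re z| < e.
  by move=> /(le_lt_trans (normc_ge_Re _)); rewrite ltcR.
have hIm (z : R[i]) (e : R) : `|z| < e%:C -> `|complex.Im z| < e.
  move=> h; rewrite -normrN -ReiNIm; apply: hRe.
  rewrite normrM [X in _ * X]normc_def /=.
  by rewrite expr0n expr1n add0r sqrtr1 mulr1.
rewrite lecE; apply/andP; split.
  apply/eqP; apply: norm_lt_eq0 => e /near[z z0 /hIm].
  by rewrite raddfB /= (ger0_Im z0) subr0.
rewrite leNgt; apply/negP => l0.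
have /near[z z0 /hRe] : 0 < - complex.Re l by rewrite oppr_gt0.
move: z0; rewrite lecE /= => /andP[_ z0].
rewrite raddfB /= ltr_norml; lra.
Qed.
End UltraLimits.

Lemma bounded_continuous (R : realType) (V W : normedModType R[i])
    (f : {linear V -> W}) (k : R[i]) :
  0 <= k -> (forall x, `|f x| <= k * `|x|) -> continuous f.
Proof.
move=> k0 hf; apply: bounded_linear_continuous; apply/linear_boundedP.
exists k; split; first exact: ger0_real.
by move=> r /ltW kr x; rewrite (le_trans (hf x))// ler_wpM2r.
Qed.

(** * Functionals and states of a unital C*-algebra in its universal representation *)

Section CStar.
Variables (R : realType) (A : cstar R).
Implicit Types (a b : A) (mu nu : dual A).

Lemma dual_eq mu nu : (forall a, mu a = nu a) -> mu = nu.
Proof.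
case: mu nu => [f cf] [g cg] /= h.
have eqf : f = g.
  case: f g h {cf cg} => f [[af] [bf]] [g [[ag] [bg]]] /= h.
  have e : f = g by apply/funext.
  by subst g; rewrite (Prop_irrelevance af ag) (Prop_irrelevance bf bg).
by subst g; rewrite (Prop_irrelevance cf cg).
Qed.

Lemma exists_dual (f : A -> R[i]) (k : R[i]) :
  linear (f : A -> (R[i])^o) -> 0 <= k -> (forall a, `|f a| <= k * `|a|) ->
  exists mu, forall a, (mu a : R[i]) = f a.
Proof.
move=> lf k0 hf.
have cf := @bounded_continuous _ _ (R[i])^o (HB.pack_for {linear A -> (R[i])^o}
  (f : A -> (R[i])^o) (GRing.isLinear.Build _ _ _ _ _ lf)) k k0 hf.
by exists (Dual cf).
Qed.

Variables (U : univrep A).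

Local Notation pi := (ur_map U).

Lemma ur_norm_le a (x : U) : `|pi a x| <= `|a| * `|x|.
Proof. exact: (ur_isometric U a (normr_ge0 a)).2. Qed.

Lemma ur_linear c a b (x : U) : pi (c *: a + b) x = c *: pi a x + pi b x.
Proof. by have [h _ _] := ur_rep U; rewrite h. Qed.

Lemma ur_mul a b (x : U) : pi (cmul a b) x = pi a (pi b x).
Proof. by have [_ h _] := ur_rep U; rewrite h. Qed.

Lemma ur_adj a (x y : U) : hdot (pi (cadj a) x) y = hdot x (pi a y).
Proof. by have [_ _ h] := ur_rep U; rewrite h//= badjEr. Qed.

Lemma exists_vector_functional (xi eta : U) :
  exists mu, vector_functional pi xi eta mu.
Proof.
apply: (@exists_dual (fun a => hdot (pi a xi) eta) (`|xi| * `|eta|)).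
- by move=> c a b /=; rewrite ur_linear hdot_linear.
- by rewrite mulr_ge0.
move=> a; apply: le_trans (hdot_CauchySchwarz _ _) _.
by rewrite [leRHS]mulrAC ler_wpM2r// mulrC ur_norm_le.
Qed.

Lemma dual_bounded mu :
  exists2 k : R[i], 0 <= k & forall a, `|mu a : R[i]| <= k * `|a|.
Proof.
have [xi [eta h]] := ur_functional U mu.
exists (`|xi| * `|eta|); first by rewrite mulr_ge0.
move=> a; rewrite h; apply: le_trans (hdot_CauchySchwarz _ _) _.
by rewrite [leRHS]mulrAC ler_wpM2r// mulrC ur_norm_le.
Qed.

Variables (e : A).
Hypotheses (e0 : e != 0) (he : is_unit e).

Lemma cadj_unit : cadj e = e.
Proof.
have h : cmul (cadj e) e = cadj e by rewrite (he _).2.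
by rewrite -[RHS]cadjK -[in RHS]h cadjM cadjK h.
Qed.

Lemma norm_unit : `|e| = 1.
Proof.
have := cnorm_adj e; rewrite (he _).2 cadj_unit expr2 => /eqP.
by rewrite -[X in X == _]mulr1 => /eqP /mulfI ->//; rewrite normr_eq0.
Qed.

(** The difference of the two sides is orthogonal to the range of every [pi a], hence zero by
    nondegeneracy. *)
Lemma ur_unit (x : U) : pi e x = x.
Proof.
apply/eqP; rewrite -subr_eq0; apply/eqP; apply: ur_nondegenerate => a y.
by rewrite hdotDr hdotNr -{1}cadj_unit -ur_adj cadjK -ur_mul (he _).1 subrr.
Qed.

Lemma vector_positive (xi : U) mu :
  vector_functional pi xi xi mu -> dual_positive mu.
Proof. by move=> h a; rewrite h ur_mul ur_adj hdot_norm exprn_ge0. Qed.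

Lemma vector_norm (xi : U) mu :
  vector_functional pi xi xi mu -> (mu e : R[i]) = `|xi| ^+ 2.
Proof. by move=> ->; rewrite ur_unit hdot_norm. Qed.

(** A positive functional is implemented by one vector [xi]; Cauchy-Schwarz bounds its norm by the
    square of [xi]'s norm, which is its value at the unit. *)
Lemma stateE mu : state mu <-> dual_positive mu /\ (mu e : R[i]) = 1.
Proof.
split=> [[mu0 mule gek]|[mu0 mue]]; split=> //.
  have [xi hxi] := ur_positive U mu0.
  have xile : `|xi| ^+ 2 <= 1.
    rewrite -(vector_norm hxi) (le_trans (real_ler_norm _))//.
      by rewrite (vector_norm hxi) realX ?normr_real.
    by rewrite (le_trans (mule e))// mul1r norm_unit.
  rewrite (vector_norm hxi); apply/eqP; rewrite eq_le xile gek// => a.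
  rewrite hxi (le_trans (hdot_CauchySchwarz _ _))// expr2.
  by rewrite [leRHS]mulrAC ler_wpM2r// mulrC ur_norm_le.
- move=> a; have [xi hxi] := ur_positive U mu0.
  have xi1 : `|xi| = 1.
    by apply/eqP; rewrite -sqrp_eq1// -(vector_norm hxi) mue.
  rewrite hxi (le_trans (hdot_CauchySchwarz _ _))// xi1 mulr1 mul1r.
  by have := ur_norm_le a xi; rewrite xi1 mulr1.
by move=> k /(_ e); rewrite mue norm_unit mulr1 normr1.
Qed.

Lemma state_vector mu : state mu ->
  exists2 xi : U, vector_functional pi xi xi mu & `|xi| = 1.
Proof.
move=> /stateE[mu0 mue]; have [xi hxi] := ur_positive U mu0.
by exists xi => //; apply/eqP; rewrite -sqrp_eq1// -(vector_norm hxi) mue.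
Qed.

(** As [e] is nonzero and the representation isometric, the space has a nonzero vector; normalized,
    it implements a state. *)
Lemma exists_state : exists mu, state mu.
Proof.
have [x x0] : exists x : U, x != 0.
  apply: contrapT => h; move/eqP: e0; apply; apply/eqP.
  rewrite -normr_le0; apply/(ur_isometric U e (lexx 0)) => x.
  have -> : x = 0 by apply/eqP/negPn/negP => x0; apply: h; exists x.
  by rewrite linear0 !normr0 mulr0.
pose xi := `|x|^-1 *: x.
have [mu hmu] := exists_vector_functional xi xi.
exists mu; apply/stateE; split; first exact: vector_positive hmu.
by rewrite (vector_norm hmu) normrZ normfV normr_id mulVf ?expr1n// normr_eq0.
Qed.
End CStar.

(** * Normal functionals: rank-one functionals and operators moved onto the vectors *)

Section Predual.
Variables (R : realType) (H : hilbert R).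

Definition single_term (x : H) (n : nat) : H := if (n == 0)%N then x else 0.

Lemma single_term_l2 (x : H) : exists k : R[i], forall n,
  \sum_(i < n) `|single_term x i| ^+ 2 <= k.
Proof.
exists (`|x| ^+ 2) => -[|n]; first by rewrite big_ord0 exprn_ge0.
by rewrite big_ord_recl big1 ?addr0// => i _; rewrite normr0 expr0n.
Qed.

Definition l2seq_single (x : H) : l2seq H := L2seq (single_term_l2 x).

Lemma pre_sum_single (x y : H) (f : H -> H -> R[i]) : f 0 0 = 0 ->
  pre_sum (Predual (l2seq_single x) (l2seq_single y)) f = f x y.
Proof.
move=> f0; rewrite /pre_sum; apply: (@cvg_lim (R[i])^o).
  exact: norm_hausdorff.
apply: cvg_near_cst; exists 1%N => // -[//|n] _.
by rewrite big_ord_recl big1 ?addr0//.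
Qed.

Lemma l2seq_map (u : l2seq H) (g : H -> H) (k : R[i]) :
  0 <= k -> (forall x, `|g x| <= k * `|x|) ->
  exists v : l2seq H, l2val v = g \o u.
Proof.
move=> k0 hg; have [M hM] := l2P u.
suff h : exists k : R[i], forall n, \sum_(i < n) `|g (u i)| ^+ 2 <= k.
  by exists (@L2seq _ _ (g \o u) h).
exists (k ^+ 2 * M) => n; apply: le_trans (ler_wpM2l (exprn_ge0 2 k0) (hM n)).
rewrite mulr_sumr ler_sum// => i _.
by rewrite -exprMn lerXn2r// nnegrE// mulr_ge0.
Qed.

Lemma bop_bounded (X : bop H) :
  exists2 k : R[i], 0 <= k & forall x, `|X x| <= k * `|x|.
Proof.
have /linear_boundedP[M [Mr hM]] :=
  continuous_linear_bounded 0 (@bfun_continuous _ _ X 0).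
exists (`|M| + 1) => [|x]; first by rewrite addr_ge0.
by apply: hM; rewrite (le_lt_trans (real_ler_norm Mr))// ltrDl ltr01.
Qed.
(** With its counterpart on the left vectors, this turns a product with a fixed operator into
    another normal functional, so translates of coefficients are coefficients. *)
Lemma pre_r_map (w : predual H) (X : bop H) : exists w' : predual H,
  forall f, pre_sum w' f = pre_sum w (fun u v => f u (X v)).
Proof.
have [k k0 hk] := bop_bounded X.
have [v hv] := l2seq_map (pre_r w) k0 hk.
exists (Predual (pre_l w) v) => f; rewrite /pre_sum /=.
by rewrite hv.
Qed.

Lemma pre_l_map (w : predual H) (X : bop H) : exists w' : predual H,
  forall f, pre_sum w' f = pre_sum w (fun u v => f (X u) v).
Proof.
have [k k0 hk] := bop_bounded X.
have [v hv] := l2seq_map (pre_l w) k0 hk.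
exists (Predual v (pre_r w)) => f; rewrite /pre_sum /=.
by rewrite hv.
Qed.
End Predual.

(** * Coefficients of [eb_V] and the operators by which functionals act on [H] *)

Section Eberlein.
Variables (R : realType).
Variables (tens : forall H K : hilbert R, htensor H K).
Variables (univ : forall A : cstar R, univrep A).
Variables (A : cstar R) (H : hilbert R) (E : eberlein tens univ A H).
Implicit Types (a b : A) (mu nu lam : dual A) (x y : H).

Local Notation "x \ot y" := (ht_tens (tens _ _) x y)
  (at level 40, left associativity).
Local Notation reg := (reg univ (A := A)).
Local Notation act := (eb_act E).
Local Notation conv := (eb_conv E).

Lemma ht_norm (K L : hilbert R) (x : K) (y : L) : `|x \ot y| = `|x| * `|y|.
Proof.
apply/eqP; rewrite -(@eqrXn2 _ 2)// ?mulr_ge0//.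
by rewrite exprMn -!hdot_norm ht_dot.
Qed.

Definition coefficient a : Prop :=
  exists w : predual H, rslice (eb_V E) w (reg a).

(** On coefficients the value of a functional depends only on the operator by which it acts. *)
Lemma rslice_act a (w : predual H) mu : rslice (eb_V E) w (reg a) ->
  (mu a : R[i]) = pre_sum w (fun u v => hdot (act mu u) v).
Proof.
move=> ha; have [xi [eta h]] := ur_functional (univ A) mu.
rewrite h ha; congr pre_sum; apply/funext => u; apply/funext => v.
by rewrite (eb_actE E h).
Qed.

(** This links weak-* limits of functionals with weak limits of their operators. *)
Lemma exists_matrix_coefficient x y :
  exists a, forall mu, (mu a : R[i]) = hdot (act mu x) y.
Proof.
have [a ha] := eb_slice_sub E (Predual (l2seq_single x) (l2seq_single y)).
exists a => mu; rewrite (rslice_act mu ha) pre_sum_single//.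
by rewrite hdot0r.
Qed.

Lemma coefficient_dense a : exists c : nat -> A,
  (forall n, coefficient (c n)) /\ c n @[n --> \oo] --> a.
Proof.
have /choice[c hc] : forall n : nat, exists b,
    coefficient b /\ `|a - b| < n.+1%:R^-1.
  move=> n; have n0 : 0 < n.+1%:R^-1 :> R[i] by rewrite invr_gt0 ltr0n.
  by have [w [b [hb ab]]] := eb_slice_dense E a n0;
    exists b; split=> //; exists w.
exists c; split=> [n|]; first exact: (hc n).1.
apply/cvgrPdist_lt => e /natSinv_lt[N hN]; exists N => // n /hN.
exact: lt_trans (hc n).2.
Qed.

Lemma dual_cvg mu (c : nat -> A) a : c n @[n --> \oo] --> a ->
  (mu (c n) : (R[i])^o) @[n --> \oo] --> mu a.
Proof. by move=> ca; apply: (cvg_comp _ _ ca); exact: dual_continuous. Qed.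

Lemma dual_eq_coefficient mu nu :
  (forall a, coefficient a -> (mu a : R[i]) = nu a) -> mu = nu.
Proof.
move=> h; apply: dual_eq => a; have [c [hc ca]] := coefficient_dense a.
apply: (cvg_eq_complex _ (dual_cvg (mu := mu) ca) (dual_cvg (mu := nu) ca)).
by apply: nearW => n; exact: h.
Qed.

Variables (e : A).
Hypotheses (e0 : e != 0) (he : is_unit e).

(** The convolution of the vector functionals at [x] and [y] is positive, hence implemented by a
    vector [z]; then [eb_Phi E a] at the tensor has the norm of [ur_map (univ A) a z]. *)
Lemma Phi_norm_le a (x y : univ A) :
  `|eb_Phi E a (x \ot y)| <= `|a| * `|x \ot y|.
Proof.
have [mu hmu] := exists_vector_functional x x.
have [nu hnu] := exists_vector_functional y y.
have hE b : (conv mu nu (cmul (cadj b) b) : R[i]) =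
    `|eb_Phi E b (x \ot y)| ^+ 2.
  have [_ hM hS] := eb_Phi_hom E.
  by rewrite (eb_convE E hmu hnu) hM// hS//= badjEr hdot_norm.
have pos : dual_positive (conv mu nu) by move=> b; rewrite hE exprn_ge0.
have [z hz] := ur_positive (univ A) pos.
(* Evaluate the convolution at the unit, where [eb_Phi] is the identity. *)
have zE : `|z| = `|x \ot y|.
  apply/eqP; rewrite -(@eqrXn2 _ 2)// -(vector_norm he hz).
  by rewrite (eb_convE E hmu hnu) (eb_Phi_unit E he) hdot_norm.
rewrite -(@ler_pXn2r _ 2)// ?nnegrE ?mulr_ge0// -hE hz ur_mul ur_adj hdot_norm.
by rewrite ler_pXn2r ?nnegrE ?mulr_ge0// -zE ur_norm_le.
Qed.

Lemma conv_state mu nu : state mu -> state nu -> state (conv mu nu).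
Proof.
move=> /(state_vector (univ A) e0 he)[x hx x1].
move=> /(state_vector (univ A) e0 he)[y hy y1].
apply/(stateE (univ A) e0 he); split=> [a|].
  have [_ hM hS] := eb_Phi_hom E.
  by rewrite (eb_convE E hx hy) hM// hS//= badjEr hdot_norm exprn_ge0.
rewrite (eb_convE E hx hy) (eb_Phi_unit E he) hdot_norm ht_norm.
by rewrite x1 y1 mulr1 expr1n.
Qed.

Lemma act_contraction mu : state mu -> opnorm_le (act mu) 1.
Proof.
move=> /(state_vector (univ A) e0 he)[xi hxi xi1] x; rewrite mul1r.
have [->|z0] := eqVneq (act mu x) 0; first by rewrite normr0.
(* Pairing [act mu x] with itself becomes a matrix entry of the contraction [eb_V] between tensors
   with the unit vector [xi]. *)
rewrite -(@ler_pM2r _ `|act mu x|) ?normr_gt0// -expr2 -hdot_norm.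
rewrite -[leLHS]ger0_norm; last by rewrite hdot_norm exprn_ge0.
rewrite (eb_actE E hxi) (le_trans (hdot_CauchySchwarz _ _))//.
rewrite [X in _ * X]ht_norm xi1 mul1r ler_wpM2r//.
by rewrite (le_trans (eb_V_contraction E _))// ht_norm xi1 !mul1r.
Qed.

(** * The ergodic theorem applied to the operators of states *)

Lemma act_semigroup :
  contraction_semigroup [set act mu | mu in [set mu | state mu]].
Proof.
split.
- by have [mu hmu] := exists_state (univ A) e0 he; exists (act mu), mu.
- move=> _ _ [mu smu <-] [nu snu <-].
  have [k k0 hk] := dual_bounded (univ A) mu.
  have [l l0 hl] := dual_bounded (univ A) nu.
  have [lam hlam] : exists lam, forall a,
      (lam a : R[i]) = 2^-1 * ((mu a : R[i]) + (nu a : R[i])).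
    apply: (exists_dual (k := 2^-1 * (k + l))) => [c a b||a].
    + by rewrite /= !linearP /GRing.scale /=; ring.
    + by rewrite mulr_ge0 ?invr_ge0// addr_ge0.
    rewrite normrM ger0_norm ?invr_ge0// -mulrA ler_wpM2l ?invr_ge0// mulrDl.
    by rewrite (le_trans (ler_normD _ _))// lerD.
  exists lam.
    move: smu snu => /(stateE (univ A) e0 he)[mu0 mu1].
    move=> /(stateE (univ A) e0 he)[nu0 nu1].
    apply/(stateE (univ A) e0 he); split=> [a|].
      by rewrite hlam mulr_ge0 ?invr_ge0// addr_ge0.
    by rewrite hlam mu1 nu1; field.
  apply: bop_eq => x; apply: hdot_inj => y.
  rewrite hdot_conj [RHS]hdot_conj; congr (_^*).
  have [a ha] := exists_matrix_coefficient x y.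
  by rewrite -ha hlam /= hdotZl hdotDl -!ha.
- move=> _ _ [mu smu <-] [nu snu <-]; exists (conv mu nu).
    exact: conv_state.
  by rewrite eb_act_hom.
- by move=> _ [mu smu <-]; exact: act_contraction.
Qed.

(* The weak-* limit of states [mu] for which [act mu] approximates the
   projection onto the common fixed vectors. *)
Lemma exists_absorbing_state : exists M, state M /\ forall mu, state mu ->
  bcomp (act mu) (act M) = act M /\ bcomp (act M) (act mu) = act M.
Proof.
have [p [fix_p p_abs p_approx]] := alaoglu_birkhoff act_semigroup.
(* The filter of states whose operators tend strongly to [p]. An ultrafilter refining it has a limit
   at each [a], since states are bounded there by the norm of [a]. *)
pose F0 : set_system (dual A) := [set Q | exists (s : seq H) (n : nat),
  forall mu, state mu ->
    (forall x, x \in s -> `|act mu x - p x| < n.+1%:R^-1) -> Q mu].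
have F0F : ProperFilter F0.
  apply: Build_ProperFilter.
    move=> [s [n h]].
    have n0 : 0 < n.+1%:R^-1 :> R[i] by rewrite invr_gt0 ltr0n.
    by have [_ [mu smu <-] hmu] := p_approx s _ n0; exact: h smu hmu.
  apply: Build_Filter.
  - by exists [::], 0%N.
  - move=> P Q [s [n hP]] [t [m hQ]]; exists (s ++ t), (maxn n m) => mu smu h.
    have le k : (k <= maxn n m)%N -> (maxn n m).+1%:R^-1 <= k.+1%:R^-1 :> R[i].
      by move=> km; rewrite lef_pV2 ?posrE ?ltr0n// ler_nat.
    split.
      apply: hP => // x xs; apply: lt_le_trans (le n (leq_maxl _ _)).
      by apply: h; rewrite mem_cat xs.
    apply: hQ => // x xs; apply: lt_le_trans (le m (leq_maxr _ _)).
    by apply: h; rewrite mem_cat xs orbT.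
  - by move=> P Q PQ [s [n hP]]; exists s, n => mu smu /(hP _ smu)/PQ.
have [F [UF F0F']] := ultraFilterLemma F0F.
have PF : ProperFilter F by exact: ultra_proper.
have Fstate : \forall mu \near F, state mu.
  by apply: F0F'; exists [::], 0%N.
pose ev a : dual A -> (R[i])^o := fun mu => mu a.
have /choice[M hM] : forall a, exists l : (R[i])^o, ev a mu @[mu --> F] --> l.
  move=> a; apply: (@ultra_cvg_complex _ _ F (ev a) `|a|) => //.
  by apply: filterS Fstate => mu [_ h _]; have := h a; rewrite mul1r.
have M_le a : `|M a| <= `|a|.
  rewrite -subr_ge0; apply: (@cvg_ge0_complex _ _ F _
    (fun mu => `|a| - `|ev a mu : R[i]|)).
    apply: cvgB; first exact: cvg_cst.
    exact: (cvg_norm (hM a)).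
  apply: filterS Fstate => mu [_ h _]; rewrite subr_ge0.
  by have := h a; rewrite mul1r.
have M_linear : linear (M : A -> (R[i])^o).
  move=> c a b; apply: (cvg_eq_complex _ (hM _) (cvgD (cvgZr (hM a)) (hM b))).
  by apply: nearW => mu; rewrite /ev linearP.
have [Md hMd] : exists Md : dual A, forall a, (Md a : R[i]) = M a.
  by apply: (exists_dual M_linear ler01) => a; rewrite mul1r.
have hMdlim a : ev a mu @[mu --> F] --> (Md a : (R[i])^o).
  by rewrite hMd.
have state_Md : state Md.
  apply/(stateE (univ A) e0 he); split=> [a|].
    apply: (cvg_ge0_complex (hMdlim _)).
    by apply: filterS Fstate => mu [mu0 _ _]; exact: mu0.
  apply: (cvg_eq_complex (g := fun=> 1) _ (hMdlim e)); last exact: cvg_cst.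
  by apply: filterS Fstate => mu /(stateE (univ A) e0 he)[].
have actMd x : act Md x = p x.
  (* Matrix entries of [act Md] are limits of those of [act mu], which converge to those of [p]
     along the filter. *)
  apply: hdot_inj => y; rewrite hdot_conj [RHS]hdot_conj; congr (_^*).
  have [a ha] := exists_matrix_coefficient x y.
  rewrite -ha; apply: (cvg_eq_complex (g := ev a) _ (hMdlim a)).
    exact: nearW.
  apply/cvgrPdist_lt => d d0.
  have y0 : 0 < `|y| + 1 by rewrite ltr_wpDl.
  have [N hN] := natSinv_lt (divr_gt0 d0 y0).
  apply: F0F'; exists [:: x], N => mu smu /(_ x (mem_head _ _)) hx.
  rewrite /ev ha distrC -hdotNl -hdotDl.
  apply: le_lt_trans (hdot_CauchySchwarz _ _) _.
  apply: (@le_lt_trans _ _ (`|act mu x - p x| * (`|y| + 1))).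
    by rewrite ler_wpM2l// lerDl.
  by rewrite -ltr_pdivlMr// (lt_trans hx)// hN.
exists Md; split=> // mu smu.
have Smu : [set act mu | mu in [set mu | state mu]] (act mu) by exists mu.
split; apply: bop_eq => x /=; rewrite !actMd.
  exact: fix_p.
exact: p_abs.
Qed.

(** * The module actions take values in the algebra *)

Section Translations.
Variable T : dual A -> dual A.
Hypothesis T_le : forall (x y : univ A) lam, vector_functional reg x y lam ->
  forall a, `|T lam a : R[i]| <= `|a| * (`|x| * `|y|).
Hypothesis T_coefficient : forall a, coefficient a ->
  exists b, forall lam, (lam b : R[i]) = T lam a.

(** Here [T] is convolution by a fixed state on either side. The translate exists for coefficients,
    and the bound [T_le] carries Cauchy sequences of coefficients to Cauchy sequences of
    translates. *)
Lemma translation_exists a : exists b, forall lam, (lam b : R[i]) = T lam a.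
Proof.
have [c [hc ca]] := coefficient_dense a.
have /choice[b hb] : forall n, exists b, forall lam,
    (lam b : R[i]) = T lam (c n).
  by move=> n; exact: T_coefficient.
have b_le n m : `|b n - b m| <= `|c n - c m|.
  apply/(ur_isometric (univ A) _ (normr_ge0 _)) => x.
  set z := ur_map _ _ x.
  have [->|z0] := eqVneq z 0; first by rewrite normr0 mulr_ge0.
  (* As [z] is the image of [x] under [b n - b m], this functional takes the squared norm of [z] at
     [b n - b m]. *)
  have [lam hlam] := exists_vector_functional x z.
  rewrite -(@ler_pM2r _ `|z|) ?normr_gt0// -expr2 -hdot_norm -hlam.
  rewrite -[leLHS]ger0_norm; last by rewrite hlam hdot_norm exprn_ge0.
  by rewrite linearB /= !hb -linearB -mulrA; exact: T_le.
have /cvg_ex[l bl] : cvgn b.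
  apply: norm_cauchy_cvgn => d d0.
  have d2 : 0 < d / 2 by rewrite divr_gt0.
  have /cvgr_dist_lt/(_ _ d2)[N _ hN] := ca.
  exists N => n m Nn Nm; rewrite (le_lt_trans (b_le n m))//.
  rewrite -(subrKA a) (le_lt_trans (ler_normD _ _))// [d]splitr.
  by rewrite ltrD//; [rewrite distrC|]; exact: hN.
exists l => lam.
apply: (cvg_eq_complex _ (dual_cvg (mu := lam) bl) (dual_cvg (mu := T lam) ca)).
by apply: nearW => n; exact: hb.
Qed.
End Translations.

Lemma conv_le (x y x' y' : univ A) mu lam :
  vector_functional reg x y mu -> vector_functional reg x' y' lam ->
  forall a, `|conv mu lam a : R[i]| <= `|a| * (`|x| * `|x'|) * (`|y| * `|y'|).
Proof.
move=> hmu hlam a.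
rewrite (eb_convE E hmu hlam) (le_trans (hdot_CauchySchwarz _ _))//.
by rewrite -(ht_norm x x') -(ht_norm y y') ler_wpM2r// Phi_norm_le.
Qed.

(** [xget] returns its default 0 unless the translate exists in [A]. For a coefficient, the adjoint
    of [act mu] is moved onto the right vectors of [w]. *)
Lemma rmodE mu lam a : state mu ->
  (lam (eb_rmod E a mu) : R[i]) = conv mu lam a.
Proof.
move=> smu; suff h : exists b, forall lam, lam b = conv mu lam a.
  by have := xgetPex 0 h; exact.
apply: (@translation_exists (conv mu)) => [x y lam' hlam b|b [w hb]].
  have [xi hxi xi1] := state_vector (univ A) e0 he smu.
  by have := conv_le hxi hlam b; rewrite xi1 !mul1r mulrA.
have [w' hw'] := pre_r_map w (bstar (act mu)).
have [c hc] := eb_slice_sub E w'.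
exists c => lam'; rewrite (rslice_act lam' hc) hw' (rslice_act _ hb) eb_act_hom.
congr pre_sum; apply/funext => u; apply/funext => v /=.
by rewrite -badjE.
Qed.

Lemma lmodE mu lam a : state mu ->
  (lam (eb_lmod E mu a) : R[i]) = conv lam mu a.
Proof.
move=> smu; suff h : exists b, forall lam, lam b = conv lam mu a.
  by have := xgetPex 0 h; exact.
apply: (@translation_exists (conv^~ mu)) => [x y lam' hlam b|b [w hb]].
  have [xi hxi xi1] := state_vector (univ A) e0 he smu.
  by have := conv_le hlam hxi b; rewrite xi1 !mulr1 mulrA.
have [w' hw'] := pre_l_map w (act mu).
have [c hc] := eb_slice_sub E w'.
exists c => lam'.
by rewrite (rslice_act lam' hc) hw' (rslice_act _ hb) eb_act_hom.
Qed.

(** * Existence and uniqueness of the invariant mean *)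

(** The homomorphism [act] is injective because coefficients are dense, so operator identities lift
    to convolution. *)
Lemma conv_eq_act mu nu lam :
  bcomp (act mu) (act nu) = act lam -> conv mu nu = lam.
Proof.
move=> h; apply: dual_eq_coefficient => a [w ha].
by rewrite !(rslice_act _ ha) eb_act_hom h.
Qed.

Lemma unique_invariant_mean : exists! M, invariant_mean E M.
Proof.
have [M [sM hM]] := exists_absorbing_state; exists M; split.
  split=> // mu smu a; have [h1 h2] := hM _ smu.
  by rewrite rmodE// lmodE// (conv_eq_act h1) (conv_eq_act h2).
move=> N [sN hN]; have [h1 h2] := hM _ sN.
(* Invariance of [N] under the state [M] gives [N a = conv M N a], and [M] absorbs [N]. *)
apply: dual_eq => a; have [<- _] := hN _ sM a.
by rewrite rmodE// (conv_eq_act h2).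
Qed.
End Eberlein.

Theorem theorem5p3 (R : realType)
  (tens : forall H K : hilbert R, htensor H K)
  (univ : forall A : cstar R, univrep A)
  (G : lcqg tens) (C : universal_alg univ G)
  (E : embedded C) (hE : is_EG E) :
  exists! M : dual (em_alg E), invariant_mean (em_eb E) M.
Proof.
have [[e e0 he] _] := hE.
exact: unique_invariant_mean e0 he.
Qed.
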